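(* Let $\overline{\mathcal{P}}^r \subset \mathbb{R}^{|\mathcal{N}^r|\,|\mathcal{T}|}$ be the (nonempty) dynamic uncertainty set described in the context, let $t_1 \le t_2$ be time periods in $\mathcal{T}$, and let $\overline{\mathcal{P}}^{r,total}_{[t_1:t_2]}$ and $\widehat{\mathcal{P}}^{r,total}_{[t_1:t_2]}$ be the projected uncertainty set and its outer approximation, with bounds $\overline{p}^{r,total,min}_{t}, \overline{p}^{r,total,max}_{t}, \underline{\triangle}^{total}_{t}, \overline{\triangle}^{total}_{t}$, as defined in the context. Consider the robust constraint $$\max_{\overline{\boldsymbol{p}}^{r,total}_{[t_1:t_2]} \in \overline{\mathcal{P}}^{r,total}_{[t_1:t_2]}} \ \sum_{t=t_1}^{t_2} a^{total}_t(\boldsymbol{W})\, \overline{p}^{r,total}_t \ \le\ b(\boldsymbol{x},\boldsymbol{w},z), \qquad ( * )$$ where $a^{total}_t(\boldsymbol{W})$, $t \in [t_1:t_2]$, and $b(\boldsymbol{x},\boldsymbol{w},z)$ are real-valued functions of the decision variables $(\boldsymbol{x},\boldsymbol{w},\boldsymbol{W},z)$. Then, for any values of the decision variables, $( * )$ is implied by $$\max_{\overline{\boldsymbol{p}}^{r,total}_{[t_1:t_2]} \in \widehat{\mathcal{P}}^{r,total}_{[t_1:t_2]}} \ \sum_{t=t_1}^{t_2} a^{total}_t(\boldsymbol{W})\, \overline{p}^{r,total}_t \ \le\ b(\boldsymbol{x},\boldsymbol{w},z),$$ and this latter constraint is equivalent to the existence of vectors $\overline{\boldsymbol{\pi}},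 \underline{\boldsymbol{\pi}}, \overline{\boldsymbol{\phi}}, \underline{\boldsymbol{\phi}} \ge 0$ such that $$\sum_{t=t_1}^{t_2} \left( \overline{p}^{r,total,max}_{t}\, \overline{\pi}_t - \overline{p}^{r,total,min}_{t}\, \underline{\pi}_t \right) + \sum_{t=t_1+1}^{t_2} \left( \overline{\triangle}^{total}_{t}\, \overline{\phi}_t - \underline{\triangle}^{total}_{t}\, \underline{\phi}_t \right) \ \le\ b(\boldsymbol{x},\boldsymbol{w},z),$$ $$\overline{\pi}_t - \underline{\pi}_t + \overline{\phi}_t - \underline{\phi}_t - \overline{\phi}_{t+1} + \underline{\phi}_{t+1} = a^{total}_t(\boldsymbol{W}) \qquad \forall\, t \in [t_1:t_2],$$ $$\overline{\phi}_{t_1} = \underline{\phi}_{t_1} = \overline{\phi}_{t_2+1} + \underline{\phi}_{t_2+1} = 0.$$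
   Context: $\mathcal{N}^r$ is the finite set of renewable (wind or solar) units and $\mathcal{T} = \{1,\dots,T\}$ is the set of time periods; $[t_1:t_2] = \{t_1, t_1+1, \dots, t_2\}$. The vectors $\overline{\boldsymbol{\pi}}, \underline{\boldsymbol{\pi}}$ are indexed by $t \in [t_1:t_2]$ and $\overline{\boldsymbol{\phi}}, \underline{\boldsymbol{\phi}}$ by $t \in [t_1:t_2+1]$; $\ge 0$ is componentwise. Dynamic uncertainty set: $\overline{\mathcal{P}}^r$ is the set of all $\overline{\boldsymbol{p}}^r = (\overline{p}^r_{it})_{i \in \mathcal{N}^r, t \in \mathcal{T}}$ (available renewable power) for which there exist $\boldsymbol{u} = (\boldsymbol{u}_t)$, $\boldsymbol{u}_t = (u_{it})_{i\in\mathcal{N}^r} \in \mathbb{R}^{|\mathcal{N}^r|}$, and $\boldsymbol{v} = (\boldsymbol{v}_t)_{t \in \mathcal{T}}$, $\boldsymbol{v}_t \in \mathbb{R}^{N_v}$, such that - $\overline{p}^r_{it} = f_{it} + g_{it} u_{it}$ for all $i \in \mathcal{N}^r$, $t \in \mathcal{T}$; - $\boldsymbol{u}_t = \sum_{l=1}^L \boldsymbol{A}^l \boldsymbol{u}_{t-l} + \boldsymbol{B} \boldsymbol{v}_t$ for all $t \in \mathcal{T}$, where $\boldsymbol{u}_{t}$ for $t \le 0$ are fixed initial data; - $\|\boldsymbol{v}_t\| \le \Gamma$ for all $t \in \mathcal{T}$, and $\sum_{t \in \mathcal{T}} \|\boldsymbol{v}_t\| \le \rho\, \Gamma\, |\mathcal{T}|$;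 - $0 \le \overline{p}^r_{it} \le \overline{p}^{r,max}_{it}$ for all $i \in \mathcal{N}^r$, $t \in \mathcal{T}$. Here $f_{it}, g_{it}, \overline{p}^{r,max}_{it} \in \mathbb{R}$, the matrices $\boldsymbol{A}^l \in \mathbb{R}^{|\mathcal{N}^r| \times |\mathcal{N}^r|}$ and $\boldsymbol{B} \in \mathbb{R}^{|\mathcal{N}^r| \times N_v}$, the lag $L$, $\Gamma > 0$, $\rho \in (0,1]$, and the dimension $N_v$ with $1 \le N_v \le |\mathcal{N}^r|$ are given, and $\|\cdot\|$ is a norm on $\mathbb{R}^{N_v}$. Projected set (total available renewable power): $$\overline{\mathcal{P}}^{r,total}_{[t_1:t_2]} = \Big\{ \overline{\boldsymbol{p}}^{r,total}_{[t_1:t_2]} = (\overline{p}^{r,total}_t)_{t \in [t_1:t_2]} : \ \exists\, \overline{\boldsymbol{p}}^r \in \overline{\mathcal{P}}^r \text{ s.t. } \overline{p}^{r,total}_t = \sum_{j \in \mathcal{N}^r} \overline{p}^r_{jt} \ \ \forall t \in [t_1:t_2] \Big\}.$$ Bounds: for $t \in \mathcal{T}$, $$\overline{p}^{r,total,min}_{t} = \min_{\overline{\boldsymbol{p}}^r \in \overline{\mathcal{P}}^r} \sum_{j \in \mathcal{N}^r} \overline{p}^r_{jt}, \qquad \overline{p}^{r,total,max}_{t} = \max_{\overline{\boldsymbol{p}}^r \in \overline{\mathcal{P}}^r} \sum_{j \in \mathcal{N}^r} \overline{p}^r_{jt},$$ and for $t \in [t_1+1:t_2]$, $$\underline{\triangle}^{total}_{t}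 = \min_{\overline{\boldsymbol{p}}^r \in \overline{\mathcal{P}}^r} \sum_{j \in \mathcal{N}^r} \left( \overline{p}^r_{jt} - \overline{p}^r_{j,t-1} \right), \qquad \overline{\triangle}^{total}_{t} = \max_{\overline{\boldsymbol{p}}^r \in \overline{\mathcal{P}}^r} \sum_{j \in \mathcal{N}^r} \left( \overline{p}^r_{jt} - \overline{p}^r_{j,t-1} \right).$$ Outer approximation: $$\widehat{\mathcal{P}}^{r,total}_{[t_1:t_2]} = \Big\{ \overline{\boldsymbol{p}}^{r,total}_{[t_1:t_2]} : \ \overline{p}^{r,total,min}_{t} \le \overline{p}^{r,total}_t \le \overline{p}^{r,total,max}_{t} \ \forall t \in [t_1:t_2], \ \ \underline{\triangle}^{total}_{t} \le \overline{p}^{r,total}_t - \overline{p}^{r,total}_{t-1} \le \overline{\triangle}^{total}_{t} \ \forall t \in [t_1+1:t_2] \Big\}.$$ In the application, $\boldsymbol{x}$ are commitment decisions, $(\boldsymbol{w},\boldsymbol{W})$ are coefficients of an affine dispatch policy depending on the total available renewable power, $z$ is the worst-case dispatch cost variable, and constraints of the form $( * )$ represent the worst-case cost, generator ramping, and storage capacity constraints, with $a^{total}_t(\boldsymbol{W})$ and $b(\boldsymbol{x},\boldsymbol{w},z)$ determined by the particular constraint; the statement uses nothing about these functions beyond their being real-valued. *)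

(* Defs.v *)
From HB Require Import structures.
From mathcomp Require Import all_boot all_order all_algebra.
From mathcomp Require Import boolp classical_sets reals.

Set Implicit Arguments.
Unset Strict Implicit.
Unset Printing Implicit Defensive.

Import Order.TTheory GRing.Theory Num.Theory.

Local Open Scope classical_set_scope.
Local Open Scope ring_scope.

(* Greatest and least element of a set of reals: they are required to belong to
   the set, unlike [sup] and [inf].  The value is 0 when there is no such
   element; in the uses below the set is the image of a nonempty compact set
   under a continuous map. *)
Definition set_max (R : realType) (S : set R) : R := xget 0 (S `&` ubound S).
Definition set_min (R : realType) (S : set R) : R := xget 0 (S `&` lbound S).

Definition is_norm (R : realType) (n : nat) (N : 'cV[R]_n -> R) : Prop :=
  [/\ forall x y, N (x + y) <= N x + N y,
      forall (a : R) x, N (a *: x) = `|a| * N x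
    & forall x, N x = 0 -> x = 0].

(* Time periods are the natural numbers 1, ..., T.  A vector indexed by the
   periods [a : b] is a function [nat -> R] that vanishes outside [a : b]. *)
Definition supported_on (R : realType) (a b : nat) (x : nat -> R) : Prop :=
  forall t : nat, ~~ (a <= t <= b)%N -> x t = 0.

(* Only [f_coef i t], [g_coef i t], [pmax i t] with t in {1, ..., T}, [A_mx l]
   with l in {1, ..., L}, and [u_init t] with 1 - L <= t <= 0 matter. *)
Record dynamic_data (R : realType) (n Nv : nat) := DynamicData {
  horizon : nat;
  lag : nat;
  f_coef : 'I_n -> nat -> R;
  g_coef : 'I_n -> nat -> R;
  pmax : 'I_n -> nat -> R;
  A_mx : nat -> 'M[R]_n;
  B_mx : 'M[R]_(n, Nv);
  u_init : int -> 'cV[R]_n;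
  vnorm : 'cV[R]_Nv -> R;
  Gamma : R;
  rho : R
}.

Definition dynamic_data_ok (R : realType) (n Nv : nat)
    (D : dynamic_data R n Nv) : Prop :=
  [/\ (1 <= Nv <= n)%N, is_norm (vnorm D), 0 < Gamma D & 0 < rho D <= 1].

Section UncertaintySets.
Variables (R : realType) (n Nv : nat) (D : dynamic_data R n Nv).
Local Notation T := (horizon D).
Local Notation L := (lag D).

(* Time runs over [int] for [u], since the recursion at t refers to
   t - 1, ..., t - L. *)
Definition uncertainty_set : set ('I_n -> nat -> R) :=
  [set p | (forall i, supported_on 1 T (p i)) /\
    exists (u : int -> 'cV[R]_n) (v : nat -> 'cV[R]_Nv),
    [/\ forall t : int, t <= 0 -> u t = u_init D t,
        forall t : nat, (1 <= t <= T)%N ->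
          u t%:Z = \sum_(1 <= l < L.+1) A_mx D l *m u (t%:Z - l%:Z)
                   + B_mx D *m v t,
        forall i (t : nat), (1 <= t <= T)%N ->
          p i t = f_coef D i t + g_coef D i t * u t%:Z i ord0,
        (forall t : nat, (1 <= t <= T)%N -> vnorm D (v t) <= Gamma D) /\
          \sum_(1 <= t < T.+1) vnorm D (v t) <= rho D * Gamma D * T%:R
      & forall i (t : nat), (1 <= t <= T)%N -> 0 <= p i t <= pmax D i t]].

Definition total_set (t1 t2 : nat) : set (nat -> R) :=
  [set x | supported_on t1 t2 x /\
    exists2 p, uncertainty_set p
      & forall t : nat, (t1 <= t <= t2)%N -> x t = \sum_(j < n) p j t].

Definition total_min (t : nat) : R :=
  set_min [set \sum_(j < n) p j t | p in uncertainty_set].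

Definition total_max (t : nat) : R :=
  set_max [set \sum_(j < n) p j t | p in uncertainty_set].

Definition delta_min (t : nat) : R :=
  set_min [set \sum_(j < n) (p j t - p j t.-1) | p in uncertainty_set].

Definition delta_max (t : nat) : R :=
  set_max [set \sum_(j < n) (p j t - p j t.-1) | p in uncertainty_set].

Definition total_outer (t1 t2 : nat) : set (nat -> R) :=
  [set x | [/\ supported_on t1 t2 x,
      forall t : nat, (t1 <= t <= t2)%N -> total_min t <= x t <= total_max t
    & forall t : nat, (t1.+1 <= t <= t2)%N ->
        delta_min t <= x t - x t.-1 <= delta_max t]].

End UncertaintySets.

(* The left-hand side of a robust constraint: the maximum of
   \sum_(t1 <= t <= t2) a_t x_t over x in S. *)
Definition robust_max (R : realType) (t1 t2 : nat) (S : set (nat -> R))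
    (a : nat -> R) : R :=
  set_max [set \sum_(t1 <= t < t2.+1) a t * x t | x in S].

Definition nonneg_on (R : realType) (a b : nat) (x : nat -> R) : Prop :=
  forall t : nat, (a <= t <= b)%N -> 0 <= x t.

(* Main.v *)
Require Import Defs.
From mathcomp Require Import all_boot all_order all_algebra.
From mathcomp Require Import boolp classical_sets reals.
From mathcomp Require Import functions topology normedtype derive.
From mathcomp Require Import ring lra zify.

Import Order.TTheory GRing.Theory Num.Theory.
Import numFieldNormedType.Exports.

Local Open Scope classical_set_scope.
Local Open Scope ring_scope.

Set Implicit Arguments.
Unset Strict Implicit.
Unset Printing Implicit Defensive.

(** The uncertainty set is the image, under a continuous map, of a compact set
of shocks [v]: the norm constraints bound every coordinate of [v], and [u] is
determined by [v] through the recursion.  Hence the four families of bounds are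
attained, and the projected set is contained in its outer approximation.  The
outer approximation is a nonempty bounded polyhedron (up to the values outside
the time window), so the equivalence is linear programming duality, obtained
from Farkas' lemma; summation by parts turns the ramp terms
[phi t * (x t - x t.-1)] into coefficients of the [x t]. *)

(** * Farkas' lemma and linear programming *)

Lemma scalar0 (R : pzRingType) (V : lmodType R) (f : V -> R) :
  scalar f -> f 0 = 0.
Proof.
move=> f_lin; apply: (addrI (f 0)).
by have := f_lin 1 0 0; rewrite scale1r !addr0 mul1r.
Qed.

Lemma scalarB (R : pzRingType) (V : lmodType R) (f : V -> R) k x y :
  scalar f -> f (x - k *: y) = f x - k * f y.
Proof. by move=> f_lin; rewrite addrC -scaleNr f_lin mulNr addrC. Qed.

(* Bartl's induction: if [i0] is needed, witnessed by [x0], project along [x0]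
   onto the kernel of [a i0]. *)
Lemma farkas (R : realFieldType) (V : lmodType R) (I : eqType) (s : seq I)
    (a : I -> V -> R) (c : V -> R) :
  uniq s -> (forall i, scalar (a i)) -> scalar c ->
  (forall x, (forall i, i \in s -> a i x <= 0) -> c x <= 0) ->
  exists2 y : I -> R, forall i, 0 <= y i
    & forall x, c x = \sum_(i <- s) y i * a i x.
Proof.
elim: s a c => [|i0 s IHs] a c /=.
  move=> _ _ c_lin c_le0; exists (fun=> 0) => // x.
  rewrite big_nil; apply/eqP; rewrite eq_le c_le0//=.
  (* Without constraints [c] is nonpositive at both [x] and [- x], hence zero. *)
  have : c (0 - 1 *: x) <= 0 by apply: c_le0.
  by rewrite scalarB// scalar0// sub0r mul1r oppr_le0.
move=> /andP[i0s us] a_lin c_lin c_le0.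
have [c_le0'|] :=
    pselect (forall x, (forall i, i \in s -> a i x <= 0) -> c x <= 0).
  have [y y_ge0 yE] := IHs a c us a_lin c_lin c_le0'.
  exists (fun i => if i == i0 then 0 else y i) => [i|x]; first by case: ifP.
  rewrite big_cons eqxx mul0r add0r yE; apply: eq_big_seq => i si.
  by case: eqP si i0s => // -> ->.
move=> /existsNP[x0 /not_implyP[ax0 /negP]]; rewrite -ltNge => cx0.
have ai0 : 0 < a i0 x0.
  rewrite ltNge; apply/negP => ai0; have := c_le0 x0.
  rewrite leNgt cx0 => /(_ _)/negP.
  by move=> /(_ _ isT); apply => i; rewrite inE => /predU1P[->|/ax0].
(* [x - t x *: x0] is the projection of [x] along [x0] onto the kernel of [a i0]; the induction
   hypothesis is applied to the forms composed with it. *)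
pose t (x : V) := a i0 x / a i0 x0.
have t_lin : scalar t.
  by move=> k x z; rewrite /t a_lin /=; field; rewrite gt_eqF.
have [||| y y_ge0 yE] := IHs (fun i x => a i x - t x * a i x0)
    (fun x => c x - t x * c x0) us.
- by move=> i k x z /=; rewrite a_lin t_lin; ring.
- by move=> k x z /=; rewrite c_lin t_lin; ring.
- move=> x ax; rewrite -scalarB//; apply: c_le0 => i.
  rewrite inE => /predU1P[->|si].
    by rewrite scalarB// /t divfK ?gt_eqF// subrr.
  by rewrite scalarB//; apply: ax.
(* The multiplier of [i0] is forced by evaluating the identity at [x0]. It is nonnegative because
   [c x0] is positive and every [a j x0] is nonpositive. *)
exists (fun i => if i == i0 then (c x0 - \sum_(j <- s) y j * a j x0) / a i0 x0
                 else y i) => [i|x].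
  case: ifP => // _; rewrite divr_ge0 ?(ltW ai0)// subr_ge0.
  apply: le_trans (ltW cx0); rewrite big_seq sumr_le0// => j sj.
  by rewrite mulr_ge0_le0// ax0.
rewrite big_cons eqxx.
rewrite [X in _ + X](_ : _ = \sum_(i <- s) y i * a i x); last first.
  by apply: eq_big_seq => i si; case: eqP si i0s => // -> ->.
have := yE x; under eq_bigr do rewrite mulrBr mulrCA.
rewrite big_split/= sumrN -mulr_sumr /t => /eqP; rewrite subr_eq => /eqP ->.
by field; rewrite gt_eqF.
Qed.

Lemma scalarZ (R : pzRingType) (V : lmodType R) (f : V -> R) k x :
  scalar f -> f (k *: x) = k * f x.
Proof. by move=> f_lin; rewrite -[k *: x]addr0 f_lin scalar0// addr0. Qed.

Lemma scalar_pair (R : comPzRingType) (V : lmodType R) (f : V -> R) (k : R) :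
  scalar f -> scalar (fun z : V * R^o => f z.1 + k * z.2).
Proof.
move=> f_lin h x y /=; rewrite f_lin (_ : h *: x.2 = h * x.2)//.
by rewrite !mulrDr mulrCA addrACA.
Qed.

(* Homogenization: [b i] and [d] become coefficients of an extra variable,
   constrained to be nonnegative by the index [None]. *)
Lemma farkas_affine (R : realFieldType) (V : lmodType R) (I : eqType)
    (s : seq I) (a : I -> V -> R) (b : I -> R) (c : V -> R) (d : R) (x0 : V) :
  uniq s -> (forall i, scalar (a i)) -> scalar c ->
  (forall i, i \in s -> a i x0 <= b i) ->
  (forall x, (forall i, i \in s -> a i x <= b i) -> c x <= d) ->
  exists y : I -> R, [/\ forall i, 0 <= y i,
    forall x, c x = \sum_(i <- s) y i * a i x & \sum_(i <- s) y i * b i <= d].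
Proof.
move=> us a_lin c_lin ax0 c_le.
pose a' o (z : V * R^o) :=
  if o is Some i then a i z.1 + (- b i) * z.2 else 0 + (- 1) * z.2.
have [||||y y_ge0 yE] := @farkas R (V * R^o)%type (option I)
    (None :: map Some s) a' (fun z => c z.1 + (- d) * z.2).
- rewrite /= map_inj_uniq; last by move=> ? ? [].
  by rewrite us andbT; apply/mapP => -[].
- case=> [i|]; first exact: (scalar_pair (- b i) (a_lin i)).
  by apply: (@scalar_pair R V (fun=> 0) _) => k u v; rewrite mulr0 addr0.
- exact: scalar_pair.
- move=> -[x t] /= a'_le0.
  have ax i : i \in s -> a i x <= b i * t.
    move=> si; have := a'_le0 (Some i).
    rewrite inE/= mem_map ?si; last by move=> ? ? [].
    by move=> /(_ isT); rewrite mulNr subr_le0.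
  have := a'_le0 None (mem_head _ _); rewrite /= add0r mulN1r oppr_le0.
  rewrite le_eqVlt mulNr subr_le0 => /predU1P[t0|t_gt0].
    rewrite -t0 mulr0 leNgt; apply/negP => cx.
    (* Here [x] is a recession direction. If [c x] were positive, moving from [x0] by [k] steps
       along [x] would stay feasible and push [c] beyond [d]. *)
    pose k := (`|d - c x0| + 1) / c x.
    have k_ge0 : 0 <= k by rewrite divr_ge0 ?(ltW cx)// addr_ge0.
    have : c (k *: x + x0) <= d.
      apply: c_le => i si; rewrite a_lin; rewrite -[b i]add0r lerD// ?ax0//.
      by rewrite mulr_ge0_le0// (le_trans (ax i si))// -t0 mulr0.
    rewrite c_lin divfK ?gt_eqF//.
    by have := ler_norm (d - c x0); lra.
  have : c (t^-1 *: x) <= d.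
    by apply: c_le => i si; rewrite scalarZ// mulrC ler_pdivrMr// ax.
  by rewrite scalarZ// mulrC ler_pdivrMr.
(* The multiplier of [None] is the slack in the last inequality: the identity is read off at
   [(x, 0)] for the linear part and at [(0, 1)] for the constants. *)
exists (y \o Some); split => [i|x|] /=; first exact: y_ge0.
  have := yE (x, 0).
  rewrite /= big_cons big_map/= !mulr0 !addr0 mulr0 add0r => ->.
  by apply: eq_bigr => i _; rewrite mulr0 addr0.
have := yE (0, 1); rewrite /= big_cons big_map/= scalar0// !mulr1 !add0r mulrN1.
under eq_bigr do rewrite scalar0// mulr1 add0r mulrN.
rewrite sumrN => /eqP; rewrite -opprD eqr_opp => /eqP ->.
by rewrite lerDr.
Qed.

(* If the supremum [sup S] were not attained, [a i x <= b i * t] and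
   [c x >= sup S * t] would force [t <= 0]; the multipliers given by Farkas'
   lemma then bound [c] away from [sup S]. *)
Lemma lp_max_attained (R : realType) (V : lmodType R) (I : eqType)
    (s : seq I) (a : I -> V -> R) (b : I -> R) (c : V -> R) (M : R) :
  uniq s -> (forall i, scalar (a i)) -> scalar c ->
  let feasible x := forall i, i \in s -> a i x <= b i in
  (exists x, feasible x) -> (forall x, feasible x -> c x <= M) ->
  exists2 x, feasible x & forall z, feasible z -> c z <= c x.
Proof.
move=> us a_lin c_lin feasible [x0 fx0] cM; apply: contrapT => noMax.
pose S := [set c x | x in [set x | feasible x]].
have supS : has_sup S.
  by split; [exists (c x0), x0|exists M => _ [x fx <-]; exact: cM].
have c_lt x : feasible x -> c x < sup S.
  move=> fx; rewrite lt_neqAle ub_le_sup ?andbT; last by exists x.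
    apply/eqP => cxE; apply: noMax; exists x => // z fz; rewrite cxE.
    by rewrite ub_le_sup; [| exact: supS.2|exists z].
  exact: supS.2.
pose a' o (z : V * R^o) :=
  if o is Some i then a i z.1 + (- b i) * z.2
  else (- 1) * c z.1 + sup S * z.2.
have [||||y y_ge0 yE] := @farkas R (V * R^o)%type (option I)
    (None :: map Some s) a' (fun z => 0 + 1 * z.2).
- rewrite /= map_inj_uniq; last by move=> ? ? [].
  by rewrite us andbT; apply/mapP => -[].
- case=> [i|]; first exact: (scalar_pair (- b i) (a_lin i)).
  apply: (@scalar_pair R V (fun x => -1 * c x)) => k u v.
  by rewrite c_lin mulrDr mulrCA.
- by apply: (@scalar_pair R V (fun=> 0) _) => k u v; rewrite mulr0 addr0.
- move=> -[x t] /= a'_le0; rewrite add0r mul1r leNgt; apply/negP => t_gt0.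
  have : feasible (t^-1 *: x).
    move=> i si; rewrite scalarZ// mulrC ler_pdivrMr//.
    have := a'_le0 (Some i).
    rewrite inE/= mem_map ?si; last by move=> ? ? [].
    by move=> /(_ isT); rewrite mulNr subr_le0.
  move/c_lt; rewrite scalarZ// mulrC ltr_pdivrMr// ltNge.
  by have := a'_le0 None (mem_head _ _); rewrite /= mulN1r addrC subr_le0 => ->.
(* At [(x, 1)] the identity expresses 1 as [y None * (sup S - c x)] plus terms that are nonpositive
   by feasibility. *)
have gap x : feasible x -> 1 <= y None * (sup S - c x).
  move=> fx; have := yE (x, 1).
  rewrite /= big_cons big_map/= add0r !mulr1 mulN1r.
  move=> E; rewrite [leLHS]E [- c x + _]addrC gerDl big_seq sumr_le0// => i si.
  by rewrite mulr_ge0_le0// mulr1 subr_le0 fx.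
have y_gt0 : 0 < y None.
  rewrite lt_neqAle y_ge0 andbT; apply/eqP => y0.
  by have := gap _ fx0; rewrite -y0 mul0r ler10.
have : sup S <= sup S - (y None)^-1.
  apply: ge_sup; first exact: supS.1.
  move=> _ [x /gap fx <-].
  by move: fx; rewrite mulrC -ler_pdivrMr// div1r; lra.
by rewrite lerDl oppr_ge0 leNgt invr_gt0 y_gt0.
Qed.

(** * Norms on column vectors *)

Section RealContinuity.
Variables (R : realType) (T : topologicalType).
Implicit Types f g : T -> R.

Lemma continuous_addr f g :
  continuous f -> continuous g -> continuous (fun x => f x + g x).
Proof. by move=> cf cg x; apply: cvgD; [exact: cf | exact: cg]. Qed.

Lemma continuous_oppr f : continuous f -> continuous (fun x => - f x).
Proof. by move=> cf x; apply: cvgN; exact: cf. Qed.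

Lemma continuous_mull f k : continuous f -> continuous (fun x => k * f x).
Proof. by move=> cf x; apply: cvgMl_tmp; exact: cf. Qed.

Lemma continuous_sumr (I : Type) (s : seq I) (P : pred I) (f : I -> T -> R) :
  (forall i, P i -> continuous (f i)) ->
  continuous (fun x => \sum_(i <- s | P i) f i x).
Proof. by apply: continuous_big; exact: add_continuous. Qed.

Lemma closed_le_cst f k : continuous f -> closed [set x | f x <= k].
Proof.
move=> cf; apply: (@preimage_closed _ _ f [set y | y <= k]).
  by move=> x _; exact: cf.
exact: closed_le.
Qed.

End RealContinuity.

Section Norms.
Variables (R : realType) (n : nat) (N : 'cV[R]_n -> R).
Hypothesis N_norm : is_norm N.

Lemma is_norm0 : N 0 = 0.
Proof. by case: N_norm => _ NZ _; rewrite -(scale0r 0) NZ normr0 mul0r. Qed.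

Lemma is_normN x : N (- x) = N x.
Proof. by case: N_norm => _ NZ _; rewrite -scaleN1r NZ normrN1 mul1r. Qed.

Lemma is_norm_ge0 x : 0 <= N x.
Proof.
case: N_norm => /(_ x (- x)) + _ _; rewrite subrr is_norm0 is_normN.
by rewrite -mulr2n pmulrn_lge0.
Qed.

Lemma is_norm_gt0 x : x != 0 -> 0 < N x.
Proof.
move=> x0; rewrite lt_neqAle is_norm_ge0 andbT; apply: contra x0 => /eqP Nx0.
by case: N_norm => _ _ /(_ x (esym Nx0)) ->.
Qed.

Lemma is_norm_dist x y : `|N x - N y| <= N (x - y).
Proof.
case: N_norm => ND _ _.
have dist u v : N u - N v <= N (u - v) by rewrite lerBlDr -{1}(subrK v u).
by rewrite ler_norml dist lerNl opprB -(is_normN (x - y)) opprB dist.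
Qed.

Lemma is_norm_le_coord x : N x <= \sum_k `|x k ord0| * N (delta_mx k ord0).
Proof.
have [ND NZ _] := N_norm.
rewrite [x in N x](_ : _ = \sum_k x k ord0 *: delta_mx k ord0); last first.
  apply/colP => i; rewrite summxE (bigD1 i)//= !mxE !eqxx mulr1 big1 ?addr0//.
  by move=> k ki; rewrite !mxE eq_sym (negbTE ki) mulr0.
elim/big_ind2 : _ => [|u a v b ua vb|k _]; first by rewrite is_norm0.
  by rewrite (le_trans (ND _ _))// lerD.
by rewrite NZ.
Qed.

(** The increment of [N] is squeezed between multiples of coordinate increments. Composing with [F]
    reduces the hypothesis to coordinates, so no topology on column vectors is involved. *)
Lemma is_norm_continuous (T : topologicalType) (F : T -> 'cV[R]_n) :
  (forall k, continuous (fun x => F x k ord0)) -> continuous (N \o F).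
Proof.
move=> cF x0.
pose h x := \sum_k `|F x k ord0 - F x0 k ord0| * N (delta_mx k ord0).
have h0 : h x @[x --> x0] --> 0.
  have -> : 0 = h x0.
    by rewrite /h big1// => k _; rewrite subrr normr0 mul0r.
  apply: continuous_sumr => k _ x.
  apply: cvgMr_tmp; apply: cvg_norm; apply: cvgB; [exact: cF | exact: cvg_cst].
apply: (@squeeze_cvgr _ _ _ _ (fun x => N (F x0) - h x)
  (fun x => N (F x0) + h x)).
- near=> x => /=; rewrite -ler_distlC distrC.
  apply: le_trans (is_norm_dist _ _) (le_trans (is_norm_le_coord _) _).
  by apply: ler_sum => k _; rewrite !mxE.
- by rewrite -[X in _ --> X]subr0; apply: cvgB => //; exact: cvg_cst.
- by rewrite -[X in _ --> X]addr0; apply: cvgD => //; exact: cvg_cst.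
Unshelve. all: by end_near. Qed.

(* The unit sphere of the sup norm is the union of the faces
   [x k = 1] of the cube, up to sign; [N] is bounded below on each face. *)
Lemma is_norm_ge_coord :
  exists2 C, 0 <= C & forall (x : 'cV[R]_n) k, `|x k ord0| <= C * N x.
Proof.
have [_ NZ _] := N_norm.
have face k : exists2 m, 0 < m & forall x : 'cV[R]_n,
    x k ord0 = 1 -> (forall j, `|x j ord0| <= 1) -> m <= N x.
  (* The face is a product of compact sets, so Tychonoff's theorem applies once vectors are encoded
     as functions with the pointwise topology. *)
  pose A j : set R := if j == k then [set 1] else `[-1, 1]%classic.
  pose S : set {ptws 'I_n -> R} := [set c | forall j, A j (c j)].
  pose v (c : {ptws 'I_n -> R}) : 'cV[R]_n := \col_j c j.
  have cptS : compact S.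
    apply: (@tychonoff _ (fun=> R : topologicalType) A) => j.
    rewrite /A; case: ifP => _.
      exact: compact_set1.
    exact: segment_compact.
  have S1 : S (fun=> 1).
    move=> j; rewrite /A; case: ifP => //= _.
    by rewrite in_itv/= lexx andbT; lra.
  have cN : continuous (N \o v).
    apply: is_norm_continuous => j.
    rewrite (_ : (fun _ => _) = (fun c : {ptws 'I_n -> R} => c j)).
      exact: (@proj_continuous _ (fun=> R : topologicalType)).
    by apply/funext => c; rewrite mxE.
  have [|c cS cmin] := compact_EVT_min _ cptS (continuous_subspaceT cN).
    by exists (fun=> 1).
  exists (N (v c)) => [|x xk xj].
    apply: is_norm_gt0; apply/eqP => /colP/(_ k).
    move: cS; rewrite inE => /(_ k); rewrite /A eqxx !mxE /= => ->.
    by move/eqP; rewrite oner_eq0.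
  have vx : v (fun j => x j ord0) = x by apply/colP => j; rewrite mxE.
  rewrite -[x in leRHS]vx; apply: cmin; rewrite inE => j; rewrite /A.
  case: eqP => [->|_] //=.
  by rewrite in_itv/= -ler_norml.
have /choice[m mP] : forall k, exists m, 0 < m /\ forall x : 'cV[R]_n,
    x k ord0 = 1 -> (forall j, `|x j ord0| <= 1) -> m <= N x.
  by move=> k; have [m m0 mN] := face k; exists m.
exists (\sum_k (m k)^-1) => [|x k].
  by rewrite sumr_ge0// => k _; rewrite invr_ge0 ltW//; case: (mP k).
(* Dividing [x] by a coordinate of largest modulus puts it on the face of index [j]; if that
   coordinate is 0, all of them are. *)
have [j _ jmax] := @Order.TotalTheory.arg_maxP _ _ _ k xpredT
  (fun k => `|x k ord0|) isT.
apply: le_trans (jmax k isT) _.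
have [xj0|xj0] := eqVneq (x j ord0) 0.
  rewrite xj0 normr0 mulr_ge0 ?is_norm_ge0// sumr_ge0// => i _.
  by rewrite invr_ge0 ltW//; case: (mP i).
have [mj0 /(_ ((x j ord0)^-1 *: x)) mjN] := mP j.
have : m j <= N ((x j ord0)^-1 *: x).
  apply: mjN => [|i]; rewrite mxE; first by rewrite mulVf.
  by rewrite normrM normfV mulrC ler_pdivrMr ?normr_gt0// mul1r; exact: jmax.
rewrite NZ normfV mulrC ler_pdivlMr ?normr_gt0// -ler_pdivlMl//.
move/le_trans; apply.
rewrite ler_wpM2r ?is_norm_ge0// (bigD1 j)//= lerDl sumr_ge0// => i _.
by rewrite invr_ge0 ltW//; case: (mP i).
Qed.

End Norms.

(** * Compactness of the uncertainty set *)

Section CompactUncertainty.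
Variables (R : realType) (n Nv : nat) (D : dynamic_data R n Nv).
Hypothesis D_ok : dynamic_data_ok D.
Local Notation T := (horizon D).
Local Notation L := (lag D).
Local Notation shocks := {ptws nat * 'I_Nv -> R}.

(** Shock sequences are stored as scalar families with the pointwise topology, so that boxes are
    compact by Tychonoff's theorem. *)
Definition shock (c : shocks) (t : nat) : 'cV[R]_Nv := \col_k c (t, k).

(* Step [k] of the recursion fills in the value of [u] at time [k]; the values
   at later times are junk. *)
Fixpoint trajectory (c : shocks) (k : nat) : int -> 'cV[R]_n :=
  if k is k'.+1 then
    let u := trajectory c k' in
    fun t => if t == k%:Z then
      \sum_(1 <= l < L.+1) A_mx D l *m u (t - l%:Z) + B_mx D *m shock c k
    else u t
  else u_init D.

Definition power (c : shocks) (i : 'I_n) (t : nat) : R :=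
  if (1 <= t <= T)%N then
    f_coef D i t + g_coef D i t * trajectory c T t%:Z i ord0
  else 0.

(** Step [m] of the recursion changes only the value at time [m]. *)
Lemma trajectory_stable c (k m : nat) (t : int) :
  (k <= m)%N -> t <= k%:Z -> trajectory c m t = trajectory c k t.
Proof.
move=> + tk; elim: m => [|m IHm]; first by rewrite leqn0 => /eqP ->.
rewrite leq_eqVlt => /predU1P[->//|km] /=.
by rewrite ifF ?IHm//; apply/eqP => tm; move: tk km; rewrite tm lez_nat; lia.
Qed.

Lemma trajectory_rec c (t : nat) : (1 <= t <= T)%N ->
  trajectory c T t%:Z =
    \sum_(1 <= l < L.+1) A_mx D l *m trajectory c T (t%:Z - l%:Z)
      + B_mx D *m shock c t.
Proof.
case: t => // t /andP[_ tT]; rewrite (trajectory_stable _ tT)//= eqxx.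
congr (_ + _); apply: eq_big_nat => l /andP[l1 _].
by rewrite (@trajectory_stable c t T)//; lia.
Qed.

(** Lags are at least 1, so the recursion refers to strictly earlier times and induction identifies
    any solution with the trajectory of its shocks. *)
Lemma trajectory_unique (u : int -> 'cV[R]_n) (c : shocks) :
  (forall t : int, t <= 0 -> u t = u_init D t) ->
  (forall t : nat, (1 <= t <= T)%N ->
     u t%:Z = \sum_(1 <= l < L.+1) A_mx D l *m u (t%:Z - l%:Z)
              + B_mx D *m shock c t) ->
  forall (k : nat) (t : int), (k <= T)%N -> t <= k%:Z -> trajectory c k t = u t.
Proof.
move=> u0 u_rec; elim=> [t _ /u0 ->//|k IHk t kT tk /=].
case: eqP => [->|tNk]; last by apply: IHk; lia.
rewrite u_rec ?kT//; congr (_ + _); apply: eq_big_nat => l /andP[l1 _].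
by rewrite IHk//; lia.
Qed.

Lemma coord_shocks_continuous (i : nat * 'I_Nv) :
  continuous (fun c : shocks => c i).
Proof. exact: (@proj_continuous _ (fun=> R : topologicalType)). Qed.

Lemma mulmx_cV_continuous (S : topologicalType) m q (A : 'M[R]_(m, q))
    (F : S -> 'cV[R]_q) (i : 'I_m) :
  (forall j, continuous (fun x => F x j ord0)) ->
  continuous (fun x => (A *m F x) i ord0).
Proof.
move=> cF; rewrite (_ : (fun _ => _) = fun x => \sum_j A i j * F x j ord0).
  by apply: continuous_sumr => j _; exact: continuous_mull.
by apply/funext => x; rewrite mxE.
Qed.

Lemma shock_continuous (t : nat) k : continuous (fun c => shock c t k ord0).
Proof.
rewrite (_ : (fun _ => _) = fun c : shocks => c (t, k)).
  exact: coord_shocks_continuous.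
by apply/funext => c; rewrite mxE.
Qed.

Lemma trajectory_continuous k t i :
  continuous (fun c => trajectory c k t i ord0).
Proof.
elim: k t i => [|k IHk] t i.
  rewrite (_ : (fun _ => _) = fun=> u_init D t i ord0) //.
  exact: cst_continuous.
have [tk|tk] := eqVneq t k.+1%:Z; last first.
  rewrite (_ : (fun _ => _) = fun c => trajectory c k t i ord0).
    exact: IHk.
  by apply/funext => c /=; rewrite (negbTE tk).
rewrite (_ : (fun _ => _) = fun c =>
    \sum_(1 <= l < L.+1) (A_mx D l *m trajectory c k (t - l%:Z)) i ord0
    + (B_mx D *m shock c k.+1) i ord0); last first.
  by apply/funext => c /=; rewrite tk eqxx mxE summxE.
apply: continuous_addr; last first.
  by apply: mulmx_cV_continuous => j; exact: shock_continuous.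
by apply: continuous_sumr => l _; apply: mulmx_cV_continuous => j; exact: IHk.
Qed.

Lemma power_continuous i t : continuous (fun c => power c i t).
Proof.
rewrite (_ : (fun _ => _) = if (1 <= t <= T)%N then
    fun c => f_coef D i t + g_coef D i t * trajectory c T t%:Z i ord0
    else fun=> 0); last by apply/funext => c; rewrite /power; case: ifP.
case: ifP => _; last exact: cst_continuous.
apply: continuous_addr; first exact: cst_continuous.
by apply: continuous_mull; exact: trajectory_continuous.
Qed.

(** Every condition bounds a continuous function of the shocks by a constant, the form for which
    closedness is immediate. *)
Definition admissible_shocks : set shocks :=
  [set c | [/\ forall t : nat, (1 <= t <= T)%N ->
        vnorm D (shock c t) <= Gamma D,
      \sum_(1 <= t < T.+1) vnorm D (shock c t) <= rho D * Gamma D * T%:R,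
      forall i (t : nat), (1 <= t <= T)%N -> - power c i t <= 0
    & forall i (t : nat), (1 <= t <= T)%N -> power c i t <= pmax D i t]].

Lemma admissible_shocks_closed : closed admissible_shocks.
Proof.
have [_ nrm _ _] := D_ok.
have cN t : continuous (fun c => vnorm D (shock c t)).
  by apply: is_norm_continuous => // k; exact: shock_continuous.
have cNP i t : continuous (fun c => - power c i t).
  by apply: continuous_oppr; exact: power_continuous.
rewrite (_ : admissible_shocks =
    \bigcap_(t in [set t | (1 <= t <= T)%N])
          [set c | vnorm D (shock c t) <= Gamma D]
    `&` [set c | \sum_(1 <= t < T.+1) vnorm D (shock c t)
                 <= rho D * Gamma D * T%:R]
    `&` \bigcap_(it in [set it : 'I_n * nat | (1 <= it.2 <= T)%N])
          [set c | - power c it.1 it.2 <= 0]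
    `&` \bigcap_(it in [set it : 'I_n * nat | (1 <= it.2 <= T)%N])
          [set c | power c it.1 it.2 <= pmax D it.1 it.2]).
  apply: closedI; [apply: closedI; [apply: closedI|]|].
  - by apply: closed_bigI => t _; exact: closed_le_cst.
  - by apply: closed_le_cst; apply: continuous_sumr => t _; exact: cN.
  - by apply: closed_bigI => it _; exact: closed_le_cst.
  - apply: closed_bigI => it _; apply: closed_le_cst.
    exact: power_continuous.
apply/seteqP; split=> [c [c1 c2 c3 c4]|c [[[c1 c2] c3] c4]].
  do ?split => //=.
  - by move=> [i t] /= /c3.
  - by move=> [i t] /= /c4.
split => // i t tT; first exact: (c3 (i, t)).
exact: (c4 (i, t)).
Qed.

Lemma uncertainty_set_compact_image :
  exists2 K : set shocks, compact K & uncertainty_set D = power @` K.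
Proof.
have [_ nrm Gamma_gt0 _] := D_ok.
have [C C_ge0 vC] := is_norm_ge_coord nrm.
(* Each coordinate of a shock is at most [C] times its norm, which is at most [Gamma D]. *)
pose M := C * Gamma D.
have M_ge0 : 0 <= M by rewrite mulr_ge0// ltW.
exists ([set c : shocks | forall i, `[- M, M]%classic (c i)]
        `&` admissible_shocks).
  apply: compact_closedI; last exact: admissible_shocks_closed.
  apply: (@tychonoff _ (fun=> R : topologicalType)
    (fun=> `[- M, M]%classic)) => i.
  exact: segment_compact.
apply/seteqP; split => p.
  move=> [p_supp [u [v [u0 u_rec pE [vG vsum] p_bnd]]]].
  (* Shocks outside the horizon are reset to 0 to keep [c] in the box; [power] does not see them. *)
  pose c : shocks := fun tk =>
    if (1 <= tk.1 <= T)%N then v tk.1 tk.2 ord0 else 0.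
  have cv t : (1 <= t <= T)%N -> shock c t = v t.
    by move=> tT; apply/colP => k; rewrite mxE /c /= tT.
  have cp : power c = p.
    apply/funext => i; apply/funext => t; rewrite /power; case: ifPn => tT.
      rewrite pE// (@trajectory_unique u)// => [s sT|].
        by rewrite u_rec// cv.
      by case/andP: tT.
    by rewrite p_supp.
  exists c => //; split.
    move=> [t k] /=; rewrite in_itv/= -ler_norml /c /=; case: ifP => tT.
      by rewrite (le_trans (vC _ _))// ler_wpM2l// vG.
    by rewrite normr0.
  split.
  - by move=> t tT; rewrite cv// vG.
  - rewrite (le_trans _ vsum)// big_nat [leRHS]big_nat ler_sum// => t tT.
    by rewrite cv.
  - by move=> i t tT; rewrite cp oppr_le0; case/andP: (p_bnd i t tT).
  - by move=> i t tT; rewrite cp; case/andP: (p_bnd i t tT).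
move=> [c [_ [c1 c2 c3 c4]] <-]; split.
  by move=> i t tT; rewrite /power (negbTE tT).
exists (trajectory c T), (shock c); split => //.
- by move=> t t0; rewrite (@trajectory_stable c 0).
- exact: trajectory_rec.
- by move=> i t tT; rewrite /power tT.
- by move=> i t tT; rewrite c4// andbT -oppr_le0 c3.
Qed.

(** Continuity of [phi] is phrased through coordinatewise continuous families of profiles, which
    [power] is, and the extreme value theorem is applied on the compact set of shocks. *)
Lemma uncertainty_set_max_attained (phi : ('I_n -> nat -> R) -> R) :
  uncertainty_set D !=set0 ->
  (forall (S : topologicalType) (F : S -> 'I_n -> nat -> R),
     (forall i t, continuous (fun x => F x i t)) -> continuous (phi \o F)) ->
  exists2 p, uncertainty_set D p &
    forall q, uncertainty_set D q -> phi q <= phi p.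
Proof.
have [K cptK ->] := uncertainty_set_compact_image.
move=> [_ [c0 Kc0 _]] phi_cont.
have cphi : continuous (phi \o power).
  by apply: phi_cont; exact: power_continuous.
have [|c cK cmax] := compact_EVT_max _ cptK (continuous_subspaceT cphi).
  by exists c0.
rewrite inE in cK; exists (power c) => [|_ [d Kd <-]]; first by exists c.
by apply: cmax; rewrite inE.
Qed.

End CompactUncertainty.

(** * Duality for the outer approximation *)

Section SetExtrema.
Variables (R : realType) (X : Type) (A : set X) (phi : X -> R).

Lemma set_max_eq (S : set R) m : S m -> ubound S m -> set_max S = m.
Proof.
move=> Sm ubm; apply: xget_unique; first by split.
move=> y [Sy uby]; apply/eqP; rewrite eq_le ubm//=; exact: uby.
Qed.

Lemma set_min_eq (S : set R) m : S m -> lbound S m -> set_min S = m.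
Proof.
move=> Sm lbm; apply: xget_unique; first by split.
move=> y [Sy lby]; apply/eqP; rewrite eq_le lbm// andbT; exact: lby.
Qed.

(** Attainment ensures that [set_max] is a true maximum and not the default value 0. *)
Lemma set_max_image_le_iff b :
  (exists2 x, A x & forall z, A z -> phi z <= phi x) ->
  set_max [set phi x | x in A] <= b <-> (forall x, A x -> phi x <= b).
Proof.
move=> [x Ax xmax]; rewrite (@set_max_eq _ (phi x)).
- by split => [xb z Az|/(_ _ Ax)//]; exact: le_trans (xmax z Az) xb.
- by exists x.
- by move=> _ [z Az <-]; exact: xmax.
Qed.

Lemma set_max_image_ge x :
  (exists2 x, A x & forall z, A z -> phi z <= phi x) ->
  A x -> phi x <= set_max [set phi x | x in A].
Proof. by move=> /set_max_image_le_iff/iffLR; apply. Qed.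

Lemma set_min_image_le x :
  (exists2 x, A x & forall z, A z -> - phi z <= - phi x) ->
  A x -> set_min [set phi x | x in A] <= phi x.
Proof.
move=> [x0 Ax0 x0min] Ax; rewrite (@set_min_eq _ (phi x0)).
- by rewrite -lerN2 x0min.
- by exists x0.
- by move=> _ [z Az <-]; rewrite -lerN2 x0min.
Qed.

End SetExtrema.

(** The two boundary terms stay explicit; the conditions on the ramp multipliers at [t1] and [t2.+1]
    cancel them in the duality proof. *)
Lemma sum_by_parts (R : comPzRingType) (t1 t2 : nat) (phi x : nat -> R) :
  (t1 <= t2)%N ->
  \sum_(t1.+1 <= t < t2.+1) phi t * (x t - x t.-1)
  = \sum_(t1 <= t < t2.+1) (phi t - phi t.+1) * x t
    - phi t1 * x t1 + phi t2.+1 * x t2.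
Proof.
move=> /subnKC <-; elim: (t2 - t1)%N => [|d IHd].
  by rewrite addn0 big_geq// big_nat1; ring.
rewrite addnS big_nat_recr/= ?IHd; last by rewrite ltnS leq_addr.
by rewrite [in RHS]big_nat_recr/= ?(leq_trans (leq_addr d t1))//; ring.
Qed.

(** * Duality for a polytope given by bounds and ramp limits *)

Section RampPolytope.
Variables (R : realType) (t1 t2 : nat) (lo hi dlo dhi a : nat -> R).
Hypothesis t12 : (t1 <= t2)%N.

(** Values outside the window are left free, so that linear programming applies on the whole space
    of sequences. *)
Definition ramp_polytope : set (nat -> R) :=
  [set x | (forall t, (t1 <= t <= t2)%N -> lo t <= x t <= hi t) /\
    (forall t, (t1.+1 <= t <= t2)%N -> dlo t <= x t - x t.-1 <= dhi t)].

Let cost (x : nat -> R) := \sum_(t1 <= t < t2.+1) a t * x t.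

(* A constraint is indexed by (is it a ramp constraint, is it an upper bound,
   time period). *)
Let cstr : eqType := (bool * bool * nat)%type.

Let cstrs : seq cstr :=
  [seq (false, u, t) | u <- [:: true; false], t <- index_iota t1 t2.+1] ++
  [seq (true, u, t) | u <- [:: true; false], t <- index_iota t1.+1 t2.+1].

(** The sign turns lower bounds into upper bounds, and [d%:R] keeps the preceding period for ramp
    constraints only. *)
Let lhs (i : cstr) (x : nat -> R) : R :=
  let: (d, u, t) := i in
  (-1) ^+ (~~ u) * (x t - d%:R * x t.-1).

Let rhs (i : cstr) : R :=
  let: (d, u, t) := i in
  if u then (if d then dhi t else hi t) else - (if d then dlo t else lo t).

Let cstrs_uniq : uniq cstrs.
Proof.
rewrite cat_uniq !allpairs_uniq ?iota_uniq// ?andbT.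
- apply/hasPn => i; case/allpairsP=> -[u t] [_ _ ->].
  by apply/negP; case/allpairsP=> -[u' t'] [_ _ []].
- by move=> [u t] [u' t'] _ _ [-> ->].
- by move=> [u t] [u' t'] _ _ [-> ->].
Qed.

Let sum_cstrs (F : cstr -> R) : \sum_(i <- cstrs) F i =
  \sum_(t1 <= t < t2.+1) (F (false, true, t) + F (false, false, t)) +
  \sum_(t1.+1 <= t < t2.+1) (F (true, true, t) + F (true, false, t)).
Proof.
by rewrite big_cat !big_allpairs_dep !big_cons !big_nil /= !addr0 !big_split.
Qed.

Let feasibleE x :
  (forall i, i \in cstrs -> lhs i x <= rhs i) <-> ramp_polytope x.
Proof.
split=> [x_le|[xb xr]].
  split=> t tt; apply/andP; split.
  - have := x_le (false, false, t).
    rewrite /lhs /rhs/= mul0r subr0 mulN1r lerN2.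
    apply; rewrite mem_cat; apply/orP; left; apply/allpairsP.
    by exists (false, t); rewrite /= !inE mem_index_iota.
  - have := x_le (false, true, t); rewrite /lhs /rhs/= mul0r subr0 mul1r.
    apply; rewrite mem_cat; apply/orP; left; apply/allpairsP.
    by exists (true, t); rewrite /= !inE mem_index_iota.
  - have := x_le (true, false, t); rewrite /lhs /rhs/= mul1r mulN1r lerN2.
    apply; rewrite mem_cat; apply/orP; right; apply/allpairsP.
    by exists (false, t); rewrite /= !inE mem_index_iota.
  - have := x_le (true, true, t); rewrite /lhs /rhs/= !mul1r.
    apply; rewrite mem_cat; apply/orP; right; apply/allpairsP.
    by exists (true, t); rewrite /= !inE mem_index_iota.
move=> i; rewrite mem_cat => /orP[]; case/allpairsP=> -[u t] [_ + ->];
  rewrite mem_index_iota ltnS /lhs /rhs.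
  by move=> /xb/andP[]; case: u; rewrite /= mul0r subr0 ?mul1r// mulN1r lerN2.
by move=> /xr/andP[]; case: u; rewrite /= ?mulN1r ?lerN2 !mul1r.
Qed.

Let lhs_scalar i : scalar (lhs i).
Proof.
case: i => -[d u] t k x y; rewrite /lhs.
have E s : (k *: x + y) s = k * x s + y s by [].
by rewrite !E; ring.
Qed.

Let cost_scalar : scalar cost.
Proof.
move=> k x y; rewrite /cost mulr_sumr -big_split/=; apply: eq_bigr => t _.
by rewrite mulrDr mulrCA.
Qed.

Lemma ramp_polytope_max_attained : ramp_polytope !=set0 ->
  exists2 x, ramp_polytope x & forall z, ramp_polytope z -> cost z <= cost x.
Proof.
move=> [x0 Px0].
have [| z /feasibleE[zb _]|x] := @lp_max_attained R (nat -> R)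
  cstr cstrs lhs rhs cost
  (* On the window the modulus of [x t] is at most the sum of the moduli of its two bounds. *)
  (\sum_(t1 <= t < t2.+1) `|a t| * (`|lo t| + `|hi t|))
  cstrs_uniq lhs_scalar cost_scalar.
- by exists x0; apply/feasibleE.
- rewrite /cost big_nat [leRHS]big_nat ler_sum// => t /zb /andP[lz zh].
  rewrite (le_trans (ler_norm _))// normrM ler_wpM2l// ler_norml.
  have := ler_norm (hi t); have := ler_norm (- lo t); rewrite normrN.
  by have := normr_ge0 (lo t); have := normr_ge0 (hi t); lra.
- by move=> /feasibleE Px xmax; exists x => // z /feasibleE; exact: xmax.
Qed.

Lemma ramp_polytope_duality (b : R) : ramp_polytope !=set0 ->
  (forall x, ramp_polytope x -> cost x <= b) <->
  exists piU piL phiU phiL : nat -> R,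
    [/\ [/\ nonneg_on t1 t2 piU, nonneg_on t1 t2 piL,
            nonneg_on t1 t2.+1 phiU & nonneg_on t1 t2.+1 phiL],
        \sum_(t1 <= t < t2.+1) (hi t * piU t - lo t * piL t)
        + \sum_(t1.+1 <= t < t2.+1) (dhi t * phiU t - dlo t * phiL t) <= b,
        forall t : nat, (t1 <= t <= t2)%N ->
          piU t - piL t + phiU t - phiL t - phiU t.+1 + phiL t.+1 = a t
      & [/\ phiU t1 = 0, phiL t1 = 0 & phiU t2.+1 + phiL t2.+1 = 0]].
Proof.
move=> [x0 Px0]; split=> [cost_le|]; last first.
  move=> [piU [piL [phiU [phiL [[piU0 piL0 phiU0 phiL0]]]]]].
  move=> obj stat [phiU1 phiL1 phi2] x [xb xr]; apply: le_trans obj.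
  (* Two nonnegative numbers with sum 0 both vanish. The rest of this direction is weak duality. *)
  have phi2E : phiU t2.+1 - phiL t2.+1 = 0.
    have := phiU0 t2.+1; have := phiL0 t2.+1; rewrite (leq_trans t12)// leqnn.
    by move=> /(_ isT) ? /(_ isT) ?; lra.
  have -> : cost x = \sum_(t1 <= t < t2.+1) (piU t - piL t) * x t
      + \sum_(t1.+1 <= t < t2.+1) (phiU t - phiL t) * (x t - x t.-1).
    rewrite (sum_by_parts (fun t => phiU t - phiL t))// phi2E phiU1 phiL1.
    rewrite subrr !mul0r subr0 addr0 -big_split /cost /= big_nat [RHS]big_nat.
    by apply: eq_bigr => t /stat <-; ring.
  apply: lerD; rewrite big_nat [leRHS]big_nat; apply: ler_sum => t tt.
    have := xb t tt; have := piU0 t tt; have := piL0 t tt; nra.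
  have tt' : (t1 <= t <= t2.+1)%N by lia.
  have := xr t tt; have := phiU0 t tt'; have := phiL0 t tt'; nra.
have [|x /feasibleE/cost_le//|y [y_ge0 yE y_obj]] :=
  @farkas_affine R (nat -> R) cstr cstrs lhs rhs cost b x0 cstrs_uniq lhs_scalar cost_scalar.
  by apply/feasibleE.
(* There is no ramp constraint at [t1] or [t2.+1]; extending the multipliers by 0 gives the boundary
   conditions. *)
pose ramp u t := if (t1 < t <= t2)%N then y (true, u, t) else 0.
exists (fun t => y (false, true, t)), (fun t => y (false, false, t)),
  (ramp true), (ramp false).
have ramp1 u : ramp u t1 = 0 by rewrite /ramp ltnn.
have ramp2 u : ramp u t2.+1 = 0 by rewrite /ramp ltnn andbF.
have ramp_ge0 u t : 0 <= ramp u t by rewrite /ramp; case: ifP.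
split; [by split=> t _| | |by rewrite !ramp1 !ramp2 addr0].
  apply: le_trans y_obj; rewrite sum_cstrs le_eqVlt; apply/orP; left; apply/eqP.
  congr (_ + _); apply: eq_big_nat => t tt; rewrite /rhs /=; first by ring.
  by rewrite /ramp tt; ring.
(* Stationarity at [t] is the identity between linear forms evaluated at the indicator of [t]. *)
move=> t tt; pose x s : R := (s == t)%:R.
have sumE (F : nat -> R) : \sum_(t1 <= s < t2.+1) F s * x s = F t.
  rewrite (bigD1_seq t) ?iota_uniq ?mem_index_iota//= /x eqxx mulr1.
  rewrite big1 ?addr0// => s.
  by move=> /negbTE ->; rewrite mulr0.
rewrite -(sumE a) -/(cost x) yE sum_cstrs.
pose phi s := ramp true s - ramp false s.
rewrite [X in _ = _ + X](_ : _ =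
    \sum_(t1.+1 <= s < t2.+1) phi s * (x s - x s.-1)).
  rewrite sum_by_parts// [X in _ = X + _](_ : _ = \sum_(t1 <= s < t2.+1)
      (y (false, true, s) - y (false, false, s)) * x s).
    rewrite !sumE /phi !ramp1 !ramp2; ring.
  by apply: eq_bigr => s _; rewrite /lhs /=; ring.
by apply: eq_big_nat => s ss; rewrite /lhs /phi /ramp ss /=; ring.
Qed.

End RampPolytope.

(** * The projected set and its outer approximation *)

Section Totals.
Variables (R : realType) (n Nv : nat) (D : dynamic_data R n Nv).
Hypotheses (D_ok : dynamic_data_ok D) (D_neq0 : uncertainty_set D !=set0).
Local Notation U := (uncertainty_set D).
Local Notation profile := ('I_n -> nat -> R).

Let total (t : nat) (p : profile) : R := \sum_(j < n) p j t.
Let delta (t : nat) (p : profile) : R := \sum_(j < n) (p j t - p j t.-1).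

Lemma total_bounds t p : U p -> total_min D t <= total t p <= total_max D t.
Proof.
move=> Up; apply/andP; split.
  apply: set_min_image_le => //.
  apply: uncertainty_set_max_attained => // S F cF.
  by apply: continuous_oppr; apply: continuous_sumr => j _.
apply: set_max_image_ge => //; apply: uncertainty_set_max_attained => // S F cF.
by apply: continuous_sumr => j _.
Qed.

Lemma delta_bounds t p : U p -> delta_min D t <= delta t p <= delta_max D t.
Proof.
have cdelta (S : topologicalType) (F : S -> profile) :
    (forall i t, continuous (fun x => F x i t)) -> continuous (delta t \o F).
  move=> cF; apply: continuous_sumr => j _; apply: continuous_addr => //.
  exact: continuous_oppr.
move=> Up; apply/andP; split.
  apply: set_min_image_le => //.
  apply: uncertainty_set_max_attained => // S F cF.
  by apply: continuous_oppr; exact: cdelta.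
by apply: set_max_image_ge => //; exact: uncertainty_set_max_attained.
Qed.

Section Window.
Variables (t1 t2 : nat).
Hypothesis t12 : (t1 <= t2)%N.
Variable a : nat -> R.
Local Notation polytope := (ramp_polytope t1 t2
  (total_min D) (total_max D) (delta_min D) (delta_max D)).

Let cost (x : nat -> R) := \sum_(t1 <= t < t2.+1) a t * x t.
Let window (x : nat -> R) (t : nat) : R := if (t1 <= t <= t2)%N then x t else 0.

Let window_supported x : supported_on t1 t2 (window x).
Proof. by move=> t /negbTE tt; rewrite /window tt. Qed.

Let cost_window x : cost (window x) = cost x.
Proof.
by apply: eq_big_nat => t tt; rewrite /window ltnS in tt *; rewrite tt.
Qed.

Lemma total_outerE x :
  total_outer D t1 t2 x <-> supported_on t1 t2 x /\ polytope x.
Proof. by split=> [[? ? ?]|[? []]]. Qed.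

(** Ramp constraints start at [t1.+1], so even [x t.-1] is read inside the window and truncation
    preserves all constraints. *)
Lemma total_outer_window x : polytope x -> total_outer D t1 t2 (window x).
Proof.
move=> [xb xr]; apply/total_outerE; split=> //; split=> t tt; rewrite /window.
  by rewrite tt xb.
by rewrite !ifT ?xr//; lia.
Qed.

Lemma total_set_sub_outer : total_set D t1 t2 `<=` total_outer D t1 t2.
Proof.
move=> x [x_supp [p Up xE]]; split=> // t tt.
  by rewrite xE//; exact: total_bounds.
rewrite !xE; [|lia|lia].
by rewrite -sumrB; exact: delta_bounds.
Qed.

Lemma polytope_neq0 : polytope !=set0.
Proof.
have [p Up] := D_neq0; exists (fun t => total t p); split=> t _.
  exact: total_bounds.
by rewrite -sumrB; exact: delta_bounds.
Qed.

Lemma total_outer_max_attained :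
  exists2 x, total_outer D t1 t2 x &
    forall z, total_outer D t1 t2 z -> cost z <= cost x.
Proof.
have [x Px xmax] := ramp_polytope_max_attained a polytope_neq0.
exists (window x); first exact: total_outer_window.
by move=> z /total_outerE[_ Pz]; rewrite cost_window; exact: xmax.
Qed.

Lemma total_set_max_attained :
  exists2 x, total_set D t1 t2 x &
    forall z, total_set D t1 t2 z -> cost z <= cost x.
Proof.
(* The cost is pulled back to the uncertainty set, where maxima of continuous functions are
   attained. *)
pose phi p := cost (total ^~ p).
have [|p Up p_max] := @uncertainty_set_max_attained _ _ _ D D_ok phi D_neq0.
  move=> S F cF; apply: continuous_sumr => t _; apply: continuous_mull.
  by apply: continuous_sumr => j _.
exists (window (total ^~ p)).
  by split=> //; exists p => // t tt; rewrite /window tt.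
move=> z [_ [q Uq zE]]; rewrite cost_window (le_trans _ (p_max q Uq))//.
rewrite le_eqVlt; apply/orP; left; apply/eqP.
by apply: eq_big_nat => t tt; rewrite zE.
Qed.

Lemma robust_max_outer_le_iff b :
  robust_max t1 t2 (total_outer D t1 t2) a <= b <->
  (forall x, polytope x -> cost x <= b).
Proof.
rewrite /robust_max set_max_image_le_iff; last exact: total_outer_max_attained.
split=> [+ x Px|cost_le x /total_outerE[_ /cost_le]//].
by move=> /(_ _ (total_outer_window Px)); rewrite -(cost_window x).
Qed.

(** Both maxima are attained, so the inclusion of the sets gives the inequality. *)
Lemma robust_max_total_le_outer :
  robust_max t1 t2 (total_set D t1 t2) a
  <= robust_max t1 t2 (total_outer D t1 t2) a.
Proof.
rewrite set_max_image_le_iff; last exact: total_set_max_attained.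
move=> x /total_set_sub_outer; apply: set_max_image_ge.
exact: total_outer_max_attained.
Qed.

End Window.

End Totals.

Unset Implicit Arguments.

Theorem proposition3 (R : realType) (n Nv : nat) (D : dynamic_data R n Nv)
  (hD : dynamic_data_ok D) (hP : uncertainty_set D !=set0)
  (t1 t2 : nat) (ht1 : (1 <= t1)%N) (ht12 : (t1 <= t2)%N)
  (ht2 : (t2 <= horizon D)%N)
  (X Wvec Wmat : Type) (a : nat -> Wmat -> R) (b : X -> Wvec -> R -> R)
  (x : X) (w : Wvec) (W : Wmat) (z : R) :
  (robust_max t1 t2 (total_outer D t1 t2) (fun t => a t W) <= b x w z ->
   robust_max t1 t2 (total_set D t1 t2) (fun t => a t W) <= b x w z) /\
  (robust_max t1 t2 (total_outer D t1 t2) (fun t => a t W) <= b x w z <->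
   exists piU piL phiU phiL : nat -> R,
     [/\ [/\ nonneg_on t1 t2 piU, nonneg_on t1 t2 piL,
             nonneg_on t1 t2.+1 phiU & nonneg_on t1 t2.+1 phiL],
         \sum_(t1 <= t < t2.+1)
             (total_max D t * piU t - total_min D t * piL t)
         + \sum_(t1.+1 <= t < t2.+1)
             (delta_max D t * phiU t - delta_min D t * phiL t) <= b x w z,
         forall t : nat, (t1 <= t <= t2)%N ->
           piU t - piL t + phiU t - phiL t - phiU t.+1 + phiL t.+1 = a t W
       & [/\ phiU t1 = 0, phiL t1 = 0 & phiU t2.+1 + phiL t2.+1 = 0]]).
Proof.
split; first by apply: le_trans; exact: robust_max_total_le_outer.
rewrite robust_max_outer_le_iff//; apply: ramp_polytope_duality => //.
exact: polytope_neq0.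
Qed.
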